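(* Let $G$ and $H$ be groups with finite inverse-closed generating sets $X$ and $Y$, respectively. (i) Let $<$ be a total ordering on $X\cup Y$ satisfying $x<y$ for all $x\in X$ and $y\in Y$, and let all shortlex orderings be defined from $<$ or its restriction to $X$ or $Y$. If the spherical conjugacy languages $\widetilde\Sigma(G,X)$ and $\widetilde\Sigma(H,Y)$ are regular, then $\widetilde\Sigma(G\times H,X\cup Y)$ is regular. (ii) If the spherical conjugacy growth series $\widetilde\sigma(G,X)$ and $\widetilde\sigma(H,Y)$ are rational, then $\widetilde\sigma(G\times H,X\cup Y)$ is rational.
   Context: Let $G$ be a group with finite inverse-closed generating set $X$, and let $\pi:X^*\to G$ be the natural projection. Fix a total ordering of $X$ and let $<_{sl}$ be the induced shortlex ordering on $X^*$ (shorter words first; words of equal length compared lexicographically). For each conjugacy class $c$ of $G$, let $z_c$ be the $<_{sl}$-least word $w\in X^*$ with $\pi(w)\in c$. The spherical conjugacy language is $\widetilde\Sigma(G,X):=\{z_c : c\text{ a conjugacy class of }G\}$. The spherical conjugacy growth series is $\widetilde\sigma(G,X)(z):=\sum_{i\ge0}|\{w\in\widetilde\Sigma(G,X): l(w)=i\}|\,z^i$, where $l(w)$ is word length; it does not depend on the ordering of $X$. A power series is rational if it is the expansion of a quotient of two polynomials. A language is regular if it is accepted by a finite state automaton. The direct product $G\times H$ is viewed as the group generated by $G$ and $H$ (hence by $X\cup Y$) with relations $[g,h]=1$ for all $g\in G$, $h\in H$. *)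

(* Defs.v *)
From HB Require Import structures.
From mathcomp Require Import all_boot all_order all_algebra.
From mathcomp Require Import finmap.
From mathcomp Require Import boolp classical_sets.

Set Implicit Arguments.
Unset Strict Implicit.
Unset Printing Implicit Defensive.

Local Open Scope group_scope.
Local Open Scope fset_scope.
Local Open Scope classical_set_scope.

Definition inverse_closed (G : groupType) (X : {fset G}) : Prop :=
  {in X, forall x, x^-1 \in X}.

(* The only subgroup containing [X] is the whole group; classically, boolean
   predicates range over all subsets of [G]. *)
Definition generates (G : groupType) (X : {fset G}) : Prop :=
  forall S : {pred G}, group_closed S -> {subset X <= S} -> forall g, g \in S.

Definition strict_total_order (A : eqType) (lt : rel A) : Prop :=
  [/\ irreflexive lt, transitive lt
    & forall a b, a != b -> lt a b || lt b a].

(* Only meaningful for words of the same length. *)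
Fixpoint lex_lt (A : eqType) (lt : rel A) (u v : seq A) : bool :=
  match u, v with
  | a :: u', b :: v' => lt a b || (a == b) && lex_lt lt u' v'
  | _, _ => false
  end.

Definition shortlex (A : eqType) (lt : rel A) : rel (seq A) :=
  fun u v => (size u < size v)%N || (size u == size v) && lex_lt lt u v.

Definition shortlex_least (A : eqType) (lt : rel A) (L : set (seq A))
    (w : seq A) : Prop :=
  L w /\ forall v, L v -> v != w -> shortlex lt w v.

Record dfa (A : finType) := Dfa {
  dfa_state :> finType;
  dfa_start : dfa_state;
  dfa_trans : dfa_state -> A -> dfa_state;
  dfa_final : {pred dfa_state} }.

Definition dfa_accepts (A : finType) (M : dfa A) (w : seq A) : bool :=
  foldl (@dfa_trans A M) (dfa_start M) w \in @dfa_final A M.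

Definition regular (A : finType) (L : set (seq A)) : Prop :=
  exists M : dfa A, L = [set w | dfa_accepts M w].

(* The condition on [Q] is what makes [P / Q] expand as a power series at 0;
   the second clause is the identity [Q * f = P] of power series. *)
Definition rational_series (f : nat -> rat) : Prop := (
  exists P Q : {poly rat}, Q`_0 != 0 /\
    forall n : nat, \sum_(i < n.+1) Q`_i * f (n - i)%N = P`_n)%R.

Section SphericalConjugacy.
Variables (G : groupType) (X : {fset G}).

Definition word_eval (w : seq X) : G := \prod_(x <- w) val x.

Definition conj_class (g : G) : set G := [set h | exists k : G, h = g ^ k].

Definition sph_conj_language (lt : rel X) : set (seq X) :=
  [set w | exists g : G, shortlex_least lt (word_eval @^-1` conj_class g) w].

Definition sph_conj_growth_series (lt : rel X) (i : nat) : rat :=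
  (#|[pred w : i.-tuple X | `[< sph_conj_language lt w >]]|%:R)%R.

End SphericalConjugacy.

Section DirectProduct.
Variables (G H : groupType) (X : {fset G}) (Y : {fset H}).

(* [X] and [Y] are identified with their images in the factors of [G * H].
   This is a genuine union: the images share the element [(1, 1)] when [X] and
   [Y] both contain the identity. *)
Definition prod_gens : {fset (G * H)%type} :=
  ([fset ((x, 1) : (G * H)%type) | x in X]
     `|` [fset ((1, y) : (G * H)%type) | y in Y])%fset.

Lemma prod_gens_inl_subproof (x : X) : (val x, 1) \in prod_gens.
Proof.
by rewrite in_fsetU; apply/orP; left; apply: in_imfset; exact: fsvalP.
Qed.

Lemma prod_gens_inr_subproof (y : Y) : (1, val y) \in prod_gens.
Proof.
by rewrite in_fsetU; apply/orP; right; apply: in_imfset; exact: fsvalP.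
Qed.

Definition prod_gens_inl (x : X) : prod_gens :=
  FSetSub (prod_gens_inl_subproof x).

Definition prod_gens_inr (y : Y) : prod_gens :=
  FSetSub (prod_gens_inr_subproof y).

End DirectProduct.

(* Main.v *)
(** A word over [X ∪ Y] is a shuffle of a word [u] over [X] and a word [v] over
    [Y], its length is the sum of theirs, and it evaluates to
    [(word_eval u, word_eval v)].  As conjugacy classes of [G * H] are products
    of conjugacy classes, minimal lengths of classes add up.  Hence the growth
    series of [G * H] is the Cauchy product of those of [G] and [H], and this
    does not depend on the chosen orderings.  When the letters of [X] precede
    those of [Y], the least shuffle of [u] and [v] is [u ++ v], so the language
    of [G * H] is the concatenation of those of [G] and [H]. *)

Require Import Defs.
From mathcomp Require Import all_boot all_order all_algebra.
From mathcomp Require Import finmap.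
From mathcomp Require Import boolp classical_sets.

Set Implicit Arguments.
Unset Strict Implicit.
Unset Printing Implicit Defensive.

Local Notation class_words g := (@word_eval _ _ @^-1` conj_class g)%classic.

(** * Shortlex orderings and their least words *)

Section Shortlex.
Variables (A : eqType) (lt : rel A).
Hypothesis lt_total : strict_total_order lt.

Lemma lex_lt_irr : irreflexive (lex_lt lt).
Proof.
case: lt_total => irr _ _; elim=> //= a u IHu.
by rewrite irr IHu eqxx.
Qed.

Lemma lex_lt_trans : transitive (lex_lt lt).
Proof.
case: lt_total => _ tr _; elim=> [|b v IHv] [|a u] [|c w] //=.
case/orP=> [ab|/andP[/eqP-> uv]]; case/orP=> [bc|/andP[/eqP<- vw]].
- by rewrite (tr _ _ _ ab bc).
- by rewrite ab.
- by rewrite bc.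
- by rewrite eqxx (IHv _ _ uv vw) orbT.
Qed.

Lemma lex_lt_connected u v :
  size u = size v -> u != v -> lex_lt lt u v || lex_lt lt v u.
Proof.
case: lt_total => _ _ tot; elim: u v => [|a u IHu] [|b v] //= [suv].
rewrite eqseq_cons; have [->|/tot/orP[->|->]] //= := eqVneq a b.
  by move=> /(IHu _ suv)/orP[]->; rewrite ?orbT.
by rewrite orbT.
Qed.

Lemma shortlex_asym u v : shortlex lt u v -> ~~ shortlex lt v u.
Proof.
rewrite /shortlex; have [//|//|suv] /= := ltngtP (size u) (size v).
by move=> uv; apply/negP => /(lex_lt_trans uv); rewrite lex_lt_irr.
Qed.

Lemma shortlex_least_uniq (L : set (seq A)) u v :
  shortlex_least lt L u -> shortlex_least lt L v -> u = v.
Proof.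
move=> [Lu lu] [Lv lv]; apply/eqP/negPn/negP => uv.
by move: (shortlex_asym (lv _ Lu uv)); rewrite lu // eq_sym.
Qed.

Lemma shortlex_least_size (L : set (seq A)) u v :
  shortlex_least lt L u -> L v -> size u <= size v.
Proof.
move=> [_ lu] Lv; have [->//|/(lu _ Lv)] := eqVneq v u.
by case/orP=> [/ltnW//|/andP[/eqP-> _]].
Qed.

End Shortlex.

(** Pick in [P] an element with the fewest [r]-predecessors: by transitivity and irreflexivity,
    anything below it would have strictly fewer. *)
Lemma exists_least (T : finType) (r : rel T) (P : pred T) x0 :
  strict_total_order r -> P x0 ->
  exists2 x, P x & forall y, P y -> y != x -> r x y.
Proof.
case=> irr tr tot Px0.
case: (arg_minnP (fun x => #|[pred z | r z x]|) Px0) => x Px min_x.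
exists x => // y Py yx; have := tot x y; rewrite eq_sym => /(_ yx)/orP[//|ryx].
suff /proper_card : [pred z | r z y] \proper [pred z | r z x].
  by rewrite ltnNge min_x.
apply/properP; split; first by apply/fintype.subsetP => z; rewrite !inE => /tr; apply.
by exists y; rewrite !inE ?irr.
Qed.

(** First minimise the length; the words of that length over a finite alphabet form a finite type,
    totally ordered by [lex_lt]. *)
Lemma exists_shortlex_least (A : finType) (lt : rel A) (L : set (seq A)) w0 :
  strict_total_order lt -> L w0 -> exists w, shortlex_least lt L w.
Proof.
move=> lt_total Lw0.
have exn : exists n, `[< exists2 w, L w & size w = n >].
  by exists (size w0); apply/asboolP; exists w0.
case: (ex_minnP exn) => n /asboolP[w1 Lw1 sw1] min_n.
pose P (w : n.-tuple A) := `[< L w >].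
have total_n : strict_total_order (fun u v : n.-tuple A => lex_lt lt u v).
  split=> [u|v u w|u v uv].
  - exact: lex_lt_irr.
  - exact: lex_lt_trans.
  - by apply: lex_lt_connected; rewrite ?size_tuple.
have Pw1 : P (tcast sw1 (in_tuple w1)).
  by apply/asboolP; rewrite val_tcast.
have [w /asboolP Lw min_w] := exists_least total_n Pw1.
exists w; split=> // v Lv vw; rewrite /shortlex size_tuple.
have : n <= size v by apply: min_n; apply/asboolP; exists v.
rewrite leq_eqVlt => /orP[/eqP nv|->//]; rewrite -nv ltnn eqxx /=.
have := min_w (tcast (esym nv) (in_tuple v)).
rewrite /P -val_eqE /= val_tcast; apply=> //; exact/asboolP.
Qed.

(** * Words, the elements they represent and their conjugacy classes *)

Section Words.
Variables (G : groupType) (X : {fset G}).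
Local Open Scope group_scope.

Lemma word_eval_cat (u v : seq X) :
  word_eval (u ++ v) = word_eval u * word_eval v.
Proof. by rewrite /word_eval big_cat. Qed.

Lemma conj_class_refl (g : G) : conj_class g g.
Proof. by exists 1; rewrite conjg1. Qed.

Lemma conj_class_eq (g h : G) : conj_class g h -> conj_class h = conj_class g.
Proof.
move=> [k ->]; apply/seteqP; split=> x [l ->].
  by exists (k * l); rewrite conjgM.
by exists (k^-1 * l); rewrite -conjgM mulgA mulgV mul1g.
Qed.

(** Removes the existential: a word in a class can itself serve to name that class. *)
Lemma sph_conj_languageP (lt : rel X) (w : seq X) :
  sph_conj_language lt w <->
  shortlex_least lt (class_words (word_eval w)) w.
Proof.
split=> [[g lw]|lw]; last by exists (word_eval w).
by rewrite (conj_class_eq (proj1 lw)).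
Qed.

Hypotheses (hinv : inverse_closed X) (hgen : generates X).

Lemma word_eval_surj (g : G) : exists w : seq X, word_eval w = g.
Proof.
(* The values of words form a subgroup containing [X]. Inverses come from reversing a word and
   inverting its letters, which stay in [X] by inverse closure. *)
pose S : {pred G} := [pred g | `[< exists w : seq X, word_eval w = g >]].
suff /asboolP : g \in S by [].
have inv_eval : forall w : seq X, exists w' : seq X, word_eval w' = (word_eval w)^-1.
  elim=> [|x w [w' ew']].
    by exists [::]; rewrite /word_eval big_nil invg1.
  exists (rcons w' [` hinv (fsvalP x)]%fset).
  rewrite -cats1 word_eval_cat ew' -(cat1s x w) word_eval_cat invgM.
  by rewrite /word_eval !big_seq1.
apply: hgen => [|x Xx].
  split=> [|_ _ /asboolP[u <-] /asboolP[v <-]]; apply/asboolP.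
    by exists [::]; rewrite /word_eval big_nil.
  by have [v' ev'] := inv_eval v; exists (u ++ v'); rewrite word_eval_cat ev'.
by apply/asboolP; exists [:: [` Xx]%fset]; rewrite /word_eval big_seq1.
Qed.

Lemma exists_sph_rep (lt : rel X) (g : G) : strict_total_order lt ->
  exists w, shortlex_least lt (class_words g) w.
Proof.
have [w <-] := word_eval_surj g => lt_total.
by apply: (@exists_shortlex_least _ _ _ w) => //; exact: conj_class_refl.
Qed.

End Words.

(** * Words over the generators of the direct product *)

Section Product.
Variables (G H : groupType) (X : {fset G}) (Y : {fset H}).

(** The tag records the factor a letter comes from. If both [X] and [Y] contain the identity, the
    shared letter has two tags, so a word may have several tagged lifts. *)
Definition prod_letter (c : X + Y) : prod_gens X Y :=
  match c with inl x => prod_gens_inl Y x | inr y => prod_gens_inr X y end.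

Lemma prod_letter_surj a : exists c, a = prod_letter c.
Proof.
have := fsvalP a; rewrite /prod_gens in_fsetU.
case/orP=> /imfsetP[z /= Zz az]; [exists (inl [` Zz]%fset) | exists (inr [` Zz]%fset)];
  exact: val_inj.
Qed.

Lemma prod_gens_inl_inj : injective (@prod_gens_inl _ _ X Y).
Proof. by move=> x x' /(congr1 val)[/val_inj]. Qed.

Lemma prod_gens_inr_inj : injective (@prod_gens_inr _ _ X Y).
Proof. by move=> y y' /(congr1 val)[/val_inj]. Qed.

Lemma prod_word_surj w : exists s, w = map prod_letter s.
Proof.
elim: w => [|a w [s ->]]; first by exists [::].
by have [c ->] := prod_letter_surj a; exists (c :: s).
Qed.

Definition lefts (s : seq (X + Y)) : seq X :=
  pmap (fun c => if c is inl x then Some x else None) s.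
Definition rights (s : seq (X + Y)) : seq Y :=
  pmap (fun c => if c is inr y then Some y else None) s.

Lemma size_lefts_rights s : size (lefts s) + size (rights s) = size s.
Proof. by elim: s => [|[x|y] s IHs] //=; rewrite ?addSn ?addnS IHs. Qed.

Lemma word_eval_prod s :
  word_eval (map prod_letter s) = (word_eval (lefts s), word_eval (rights s)).
Proof.
rewrite /word_eval; elim: s => [|[x|y] s IHs] /=; rewrite ?big_nil // !big_cons IHs.
  by congr (_, _); rewrite /= mul1g.
by congr (_, _); rewrite /= mul1g.
Qed.

Definition prod_word (u : seq X) (v : seq Y) : seq (prod_gens X Y) :=
  map (prod_gens_inl Y) u ++ map (@prod_gens_inr _ _ X Y) v.

Lemma word_eval_prod_word u v :
  word_eval (prod_word u v) = (word_eval u, word_eval v).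
Proof.
have -> : prod_word u v = map prod_letter (map inl u ++ map inr v).
  by rewrite map_cat -!map_comp.
rewrite word_eval_prod.
have -> : lefts (map inl u ++ map inr v) = u.
  by elim: u => [|x u /= ->] //; elim: v.
suff -> : rights (map inl u ++ map inr v) = v by [].
by elim: u => [|x u] //=; elim: v => //= y v ->.
Qed.

Lemma conj_class_pair (g a : G) (h b : H) :
  conj_class (g, h) (a, b) <-> conj_class g a /\ conj_class h b.
Proof.
split=> [[[k l] [-> ->]]|[[k ->] [l ->]]]; last by exists (k, l).
by split; [exists k | exists l].
Qed.

(** The word [prod_word u v] gives the upper bound; the two projections of a lift of [w] lie in the
    factor classes and give the lower bound. Only lengths matter, so the three orderings may be
    unrelated. *)
Lemma prod_class_size (ltX : rel X) (ltY : rel Y) (lt : rel (prod_gens X Y))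
    g h u v w :
  shortlex_least ltX (class_words g) u ->
  shortlex_least ltY (class_words h) v ->
  shortlex_least lt (class_words (g, h)) w ->
  size w = size u + size v.
Proof.
move=> lu lv lw; apply/eqP; rewrite eqn_leq; apply/andP; split.
  have := shortlex_least_size (v := prod_word u v) lw.
  rewrite size_cat !size_map; apply.
  rewrite /= word_eval_prod_word; apply/conj_class_pair.
  by split; [case: lu | case: lv].
have [s ws] := prod_word_surj w.
have := proj1 lw; rewrite ws /= word_eval_prod => /conj_class_pair[cl cr].
rewrite size_map -size_lefts_rights leq_add //.
  exact: shortlex_least_size lu cl.
exact: shortlex_least_size lv cr.
Qed.

(** * Least words when the letters of [X] precede those of [Y] *)

Section Ordered.
Variable lt : rel (prod_gens X Y).
Hypothesis lt_total : strict_total_order lt.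
Hypothesis lt_inl_inr : forall x y, lt (prod_gens_inl Y x) (prod_gens_inr X y).

Let ltX : rel X := fun x x' => lt (prod_gens_inl Y x) (prod_gens_inl Y x').
Let ltY : rel Y := fun y y' => lt (prod_gens_inr X y) (prod_gens_inr X y').

Lemma ltX_total : strict_total_order ltX.
Proof.
case: lt_total => irr tr tot; split=> [x|y x z|x y xy]; [exact: irr | exact: tr|].
by apply: tot; apply: contra_neq xy; exact: prod_gens_inl_inj.
Qed.

Lemma ltY_total : strict_total_order ltY.
Proof.
case: lt_total => irr tr tot; split=> [x|y x z|x y xy]; [exact: irr | exact: tr|].
by apply: tot; apply: contra_neq xy; exact: prod_gens_inr_inj.
Qed.

(** Moving the letters of [X] to the front and lowering each projection can only lower a shuffle.
    The proof compares first letters, by induction on the shuffle [s]. *)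
Lemma prod_word_least_shuffle s u v :
  size u = size (lefts s) -> size v = size (rights s) ->
  (u == lefts s) || lex_lt ltX u (lefts s) ->
  (v == rights s) || lex_lt ltY v (rights s) ->
  (prod_word u v == map prod_letter s) ||
  lex_lt lt (prod_word u v) (map prod_letter s).
Proof.
elim: s u v => [|[x'|y'] s IHs] u v /=.
- by move=> /size0nil-> /size0nil->.
- case: u => [//|x u] [su] sv; rewrite eqseq_cons /= => ux vs.
  have := IHs u v su sv; move: ux; rewrite eqseq_cons /=.
  have [->|_] := eqVneq x x'; rewrite ?eqxx /=; last first.
    by rewrite orbF => xx' _; rewrite [lt _ _]xx' orbT.
  case: lt_total => irr _ _; rewrite {1}/ltX irr /= => ux /(_ ux vs).
  by move=> /orP[->//|->]; rewrite !orbT.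
(* The shuffle starts in [Y]. A nonempty [u] already wins at its first letter; otherwise the heads
   of [v] and of the shuffle are compared within [Y]. *)
- case: u => [|x u]; last by rewrite /= lt_inl_inr orbT.
  case: v => [//|y v] su [sv] us; rewrite !eqseq_cons /= => vy.
  have := IHs [::] v su sv us; move: vy; rewrite /prod_word /=.
  have [->|_] := eqVneq y y'; rewrite ?eqxx /=; last first.
    by rewrite orbF => yy' _; rewrite [lt _ _]yy' orbT.
  case: lt_total => irr _ _; rewrite {1}/ltY irr /= => vy /(_ vy).
  by move=> /orP[->//|->]; rewrite !orbT.
Qed.

Lemma prod_word_least g h u v :
  shortlex_least ltX (class_words g) u ->
  shortlex_least ltY (class_words h) v ->
  shortlex_least lt (class_words (g, h)) (prod_word u v).
Proof.
move=> lu lv; split.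
  rewrite /= word_eval_prod_word; apply/conj_class_pair.
  by split; [case: lu | case: lv].
move=> w; have [s ->] := prod_word_surj w.
rewrite /= word_eval_prod => /conj_class_pair[cl cr] neq.
have sl := shortlex_least_size lu cl; have sr := shortlex_least_size lv cr.
rewrite /shortlex size_cat !size_map -size_lefts_rights.
have [//|ge_s] := ltnP (size u + size v) _.
(* Each projection is at least as long as the least word of its class, so a competitor that is not
   longer in total must match both lengths. *)
have [su sv] : size u = size (lefts s) /\ size v = size (rights s).
  split; apply/eqP; rewrite eqn_leq ?sl ?sr /=.
    by rewrite -(leq_add2r (size (rights s))) (leq_trans ge_s) // leq_add2l.
  by rewrite -(leq_add2l (size (lefts s))) (leq_trans ge_s) // leq_add2r.
rewrite su sv eqxx /=.
have := prod_word_least_shuffle su sv; rewrite [_ == map _ _]eq_sym (negPf neq).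
apply.
- have [//|ne] := eqVneq; case: lu => _ /(_ _ cl); rewrite eq_sym => /(_ ne).
  by rewrite /shortlex su ltnn eqxx.
- have [//|ne] := eqVneq; case: lv => _ /(_ _ cr); rewrite eq_sym => /(_ ne).
  by rewrite /shortlex sv ltnn eqxx.
Qed.

Hypotheses (hXinv : inverse_closed X) (hXgen : generates X).
Hypotheses (hYinv : inverse_closed Y) (hYgen : generates Y).

Lemma sph_conj_language_prod :
  sph_conj_language lt =
  [set w | exists u v, [/\ sph_conj_language ltX u, sph_conj_language ltY v
                        & w = prod_word u v]]%classic.
Proof.
apply/seteqP; split=> w /=.
  move=> [[g h] lw].
  have [u lu] := exists_sph_rep hXinv hXgen g ltX_total.
  have [v lv] := exists_sph_rep hYinv hYgen h ltY_total.
  exists u, v; split; [by exists g | by exists h |].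
  exact: (shortlex_least_uniq lt_total lw (prod_word_least lu lv)).
by move=> [u [v [[g lu] [h lv] ->]]]; exists (g, h); exact: prod_word_least.
Qed.

(** A letter shared by both factors would precede itself under [lt], so the ordering hypothesis
    forces the two alphabets to be disjoint. *)
Lemma prod_letter_bij : bijective prod_letter.
Proof.
have inlr x y : prod_gens_inl Y x = prod_gens_inr X y -> False.
  by case: lt_total => irr _ _ e; have := lt_inl_inr x y; rewrite e irr.
have inj : injective prod_letter.
  move=> [x|y] [x'|y'] /=; first by move=> /prod_gens_inl_inj->.
  - by move/inlr.
  - by move/esym/inlr.
  - by move=> /prod_gens_inr_inj->.
pose dec a := projT1 (cid (prod_letter_surj a)).
have decK : cancel dec prod_letter by move=> a; rewrite /dec; case: cid.
by exists dec => // c; apply: inj; rewrite decK.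
Qed.

End Ordered.
End Product.

(** * Concatenation of regular languages over disjoint alphabets *)

Section ConcatAutomaton.
Variables (A B C : finType) (dec : C -> A + B).
Variables (M : dfa A) (N : dfa B).

(* Since the alphabets are disjoint, the first letter of [B] tells when to leave
   [M], so no subset construction is needed; [None] is a rejecting sink. *)
Definition cat_trans (s : option (M + N)) (c : C) : option (M + N) :=
  match s, dec c with
  | Some (inl p), inl a => Some (inl (dfa_trans p a))
  | Some (inl p), inr b =>
      if p \in @dfa_final _ M then Some (inr (dfa_trans (dfa_start N) b)) else None
  | Some (inr q), inr b => Some (inr (dfa_trans q b))
  | _, _ => None
  end.

(** A run still in [M] has read no letter of [B]; its second factor is empty, so the start state of
    [N] must be final as well. *)
Definition cat_final : {pred option (M + N)} :=
  [pred s | match s with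
            | Some (inl p) => (p \in @dfa_final _ M) && (dfa_start N \in @dfa_final _ N)
            | Some (inr q) => q \in @dfa_final _ N
            | None => false
            end].

Definition cat_dfa : dfa C :=
  @Dfa C (option (M + N)) (Some (inl (dfa_start M))) cat_trans cat_final.

Variable enc : A + B -> C.
Hypotheses (encK : cancel enc dec) (decK : cancel dec enc).

Lemma cat_trans_sink w : foldl cat_trans None w = None.
Proof. by elim: w. Qed.

Lemma cat_trans_inr q w :
  foldl cat_trans (Some (inr q)) w \in cat_final <->
  exists2 v, w = map (enc \o inr) v
           & foldl (@dfa_trans _ N) q v \in @dfa_final _ N.
Proof.
elim: w q => [|c w IHw] q /=.
  by split=> [Fq|[[|//] _]]; first by exists [::].
split.
  rewrite -[in c :: w](decK c); case: (dec c) => [a|b].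
    by rewrite cat_trans_sink.
  by move=> /IHw[v -> Fv]; exists (b :: v).
case=> -[//|b v] /= [-> ew]; rewrite encK => Fv.
by apply/IHw; exists v.
Qed.

(** Induction with [p] general: letters of [A] move within [M], and the first letter of [B] requires
    a final state of [M] and hands over to [cat_trans_inr]. *)
Lemma cat_trans_inl p w :
  foldl cat_trans (Some (inl p)) w \in cat_final <->
  exists u v, [/\ w = map (enc \o inl) u ++ map (enc \o inr) v,
                  foldl (@dfa_trans _ M) p u \in @dfa_final _ M
                & dfa_accepts N v].
Proof.
elim: w p => [|c w IHw] p /=.
  split=> [/andP[Fp F0]|[[|a u] [[|b v] [// _ Fp F0]]]].
    by exists [::], [::].
  by apply/andP.
split.
  rewrite -[in c :: w](decK c); case: (dec c) => [a|b].
    by move=> /IHw[u [v [-> Fu Fv]]]; exists (a :: u), v.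
  case: ifP => [Fp|_]; last by rewrite cat_trans_sink.
  by move=> /cat_trans_inr[v -> Fv]; exists [::], (b :: v).
case=> -[|a u] [v [/= ew Fu Fv]].
  case: v ew Fv => [//|b v] /= [-> ->]; rewrite encK Fu => Fv.
  by apply/cat_trans_inr; exists v.
case: ew => -> ew; rewrite encK.
by apply/IHw; exists u, v.
Qed.

End ConcatAutomaton.

Lemma regular_cat (A B C : finType) (enc : A + B -> C)
    (K : set (seq A)) (L : set (seq B)) :
  bijective enc -> regular K -> regular L ->
  regular [set w | exists u v, [/\ K u, L v
    & w = map (enc \o inl) u ++ map (enc \o inr) v]]%classic.
Proof.
move=> [dec encK decK] [M ->] [N ->]; exists (cat_dfa dec M N).
apply/seteqP; split=> w /=.
  by move=> [u [v [Mu Nv ->]]]; apply/(cat_trans_inl _ encK decK); exists u, v.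
by move=> /(cat_trans_inl _ encK decK)[u [v [-> Mu Nv]]]; exists u, v.
Qed.

(** * Counting words by length and Cauchy products *)

Definition words_of (A : finType) (L : set (seq A)) n : seq (seq A) :=
  map val (enum [pred w : n.-tuple A | `[< L w >]]).

Lemma mem_words_of (A : finType) (L : set (seq A)) n w :
  w \in words_of L n <-> L w /\ size w = n.
Proof.
split=> [/mapP[t + ->]|[Lw <-]].
  by rewrite mem_enum => /asboolP Lt; rewrite size_tuple.
by apply/mapP; exists (in_tuple w); rewrite // mem_enum; apply/asboolP.
Qed.

Lemma words_of_uniq (A : finType) (L : set (seq A)) n : uniq (words_of L n).
Proof. by rewrite map_inj_uniq ?enum_uniq //; exact: val_inj. Qed.

(** The map [h] is a length-additive bijection from pairs in [K] and [L] onto [M]; sort the pairs by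
    the length [i] of the first component. *)
Lemma card_words_cauchy (A B C : finType) (K : set (seq A)) (L : set (seq B))
    (M : set (seq C)) (h : seq A -> seq B -> seq C) :
  (forall u v, K u -> L v -> size (h u v) = size u + size v) ->
  (forall u v u' v', K u -> L v -> K u' -> L v' ->
     h u v = h u' v' -> u = u' /\ v = v') ->
  (forall w, M w <-> exists u v, [/\ K u, L v & w = h u v]) ->
  forall n, size (words_of M n) =
    \sum_(i < n.+1) size (words_of K i) * size (words_of L (n - i)).
Proof.
move=> h_size h_inj h_im n.
pose t i := [seq (u, v) | u <- words_of K i, v <- words_of L (n - i)].
have tP i p : p \in t i ->
    [/\ K p.1, L p.2, size p.1 = i & size p.2 = n - i].
  by move=> /allpairsP[[u v] [/mem_words_of[? ?] /mem_words_of[? ?] ->]].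
pose ws := [seq h p.1 p.2 | i <- iota 0 n.+1, p <- t i].
have /perm_size -> : perm_eq (words_of M n) ws.
  apply: uniq_perm; first exact: words_of_uniq.
    apply: allpairs_uniq_dep; first exact: iota_uniq.
      move=> i _; apply: allpairs_uniq; try exact: words_of_uniq.
      by move=> [u v] [u' v'].
    (* No repetition across different [i]: injectivity of [h] recovers the pair, and [i] is the
       length of its first component. *)
    move=> _ _ /allpairsPdep[i [p [_ /tP[Kp Lp si _] ->]]]
      /allpairsPdep[j [q [_ /tP[Kq Lq sj _] ->]]] /=.
    case: p q Kp Lp si Kq Lq sj => [u v] [u' v'] /= Ku Lv su Ku' Lv' su' e.
    have [eu ev] := h_inj _ _ _ _ Ku Lv Ku' Lv' e.
    by move: su su'; rewrite eu ev => -> ->.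
  move=> w; apply/idP/idP.
    move=> /mem_words_of[/h_im[u [v [Ku Lv ->]]] sw].
    rewrite h_size // in sw.
    apply/allpairsPdep; exists (size u), (u, v); split=> //.
      by rewrite mem_iota /= add0n ltnS -sw leq_addr.
    apply/allpairsP; exists (u, v); split=> //; apply/mem_words_of; split=> //.
    by rewrite -sw addKn.
  move=> /allpairsPdep[i [p [+ /tP[Kp Lp si sni] ->]]].
  rewrite mem_iota /= add0n ltnS => le_in.
  apply/mem_words_of; split; first by apply/h_im; exists p.1, p.2.
  by rewrite h_size // si sni subnKC.
rewrite size_allpairs_dep sumnE big_map -/(index_iota 0 n.+1) big_mkord.
by apply: eq_bigr => i _; rewrite size_allpairs.
Qed.

Import GRing.Theory.

(** * Products of rational power series *)

Section RationalSeries.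
Local Open Scope ring_scope.

(** This is multiplication modulo ['X^n.+1], which lets truncations stand in for power series. *)
Lemma coefM_eq (p p' q q' : {poly rat}) n :
  (forall i, (i <= n)%N -> p`_i = p'`_i) ->
  (forall i, (i <= n)%N -> q`_i = q'`_i) -> (p * q)`_n = (p' * q')`_n.
Proof.
move=> pp' qq'; rewrite !coefM; apply: eq_bigr => i _.
by rewrite pp' ?leq_ord // qq' // leq_subr.
Qed.

(* Power series identities at index [n] are read off the polynomial truncations
   at [n.+1]. *)
Lemma rational_series_mul (f g h : nat -> rat) :
  rational_series f -> rational_series g ->
  (forall n, h n = \sum_(i < n.+1) f i * g (n - i)%N) -> rational_series h.
Proof.
move=> [P [Q [Q0 QP]]] [R [S [S0 SR]]] hE.
exists (P * R), (Q * S); split; first by rewrite coef0M mulf_neq0.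
move=> n; pose trunc (k : nat -> rat) := \poly_(i < n.+1) k i.
have truncE k i : (i <= n)%N -> (trunc k)`_i = k i.
  by move=> le_in; rewrite coef_poly ltnS le_in.
have numE (U V : {poly rat}) k i : (i <= n)%N ->
    (forall m, \sum_(j < m.+1) V`_j * k (m - j)%N = U`_m) ->
    (V * trunc k)`_i = U`_i.
  move=> le_in <-; rewrite coefM; apply: eq_bigr => j _.
  by rewrite truncE // (leq_trans (leq_subr _ _)).
transitivity (Q * S * trunc h)`_n.
  by rewrite coefM; apply: eq_bigr => i _; rewrite truncE // leq_subr.
transitivity (Q * S * (trunc f * trunc g))`_n.
  apply: coefM_eq => // i le_in; rewrite truncE // hE coefM.
  apply: eq_bigr => j _; rewrite !truncE ?(leq_trans (leq_subr _ _)) //.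
  by rewrite (leq_trans (leq_ord j)).
rewrite mulrACA; apply: coefM_eq => i le_in; exact: numE.
Qed.

End RationalSeries.

(** For an arbitrary ordering the least word of a product class need not be [prod_word u v]. A pair
    of least words is instead sent to the chosen least word of its product class, whose length is
    known from [prod_class_size]. *)
Lemma sph_conj_growth_series_prod (G H : groupType) (X : {fset G}) (Y : {fset H})
    (ltX : rel X) (ltY : rel Y) (lt : rel (prod_gens X Y)) :
  inverse_closed X -> generates X -> inverse_closed Y -> generates Y ->
  strict_total_order ltX -> strict_total_order ltY -> strict_total_order lt ->
  forall n, (sph_conj_growth_series lt n =
    \sum_(i < n.+1)
      sph_conj_growth_series ltX i * sph_conj_growth_series ltY (n - i)%N)%R.
Proof.
move=> hXinv hXgen hYinv hYgen tX tY tXY.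
have growthE (K : groupType) (Z : {fset K}) (r : rel Z) i :
    sph_conj_growth_series r i = (size (words_of (sph_conj_language r) i))%:R%R.
  by rewrite size_map -cardE.
have repX g := exists_sph_rep hXinv hXgen g tX.
have repY h := exists_sph_rep hYinv hYgen h tY.
have rep_ex p : exists w,
    shortlex_least lt (class_words p) w.
  case: p => g h; have [u [Lu _]] := repX g; have [v [Lv _]] := repY h.
  apply: (@exists_shortlex_least _ _ _ (prod_word u v)) => //.
  by rewrite /= word_eval_prod_word; apply/conj_class_pair.
pose rep p := projT1 (cid (rep_ex p)).
have repP p : shortlex_least lt (class_words p) (rep p).
  by rewrite /rep; case: cid.
move=> n; rewrite growthE.
rewrite (@card_words_cauchy _ _ _ (sph_conj_language ltX) (sph_conj_language ltY)
  _ (fun u v => rep (word_eval u, word_eval v))).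
- rewrite natr_sum; apply: eq_bigr => i _.
  by rewrite natrM !growthE.
- move=> u v /sph_conj_languageP lu /sph_conj_languageP lv.
  exact: prod_class_size lu lv (repP _).
- move=> u v u' v' /sph_conj_languageP lu /sph_conj_languageP lv.
  move=> /sph_conj_languageP lu' /sph_conj_languageP lv' e.
  (* The common representative lies in both product classes, so the classes agree in each factor,
     and uniqueness of least words gives equal pairs. *)
  have := proj1 (repP (word_eval u', word_eval v')); rewrite -e /= => c'.
  have := proj1 (repP (word_eval u, word_eval v)); rewrite /= => c.
  move: c c'; case: (word_eval (rep _)) => a b.
  move=> /conj_class_pair[/conj_class_eq ca /conj_class_eq cb].
  move=> /conj_class_pair[/conj_class_eq ca' /conj_class_eq cb'].
  rewrite -ca in lu; rewrite -ca' in lu'; rewrite -cb in lv; rewrite -cb' in lv'.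
  by split; [exact: shortlex_least_uniq lu lu' | exact: shortlex_least_uniq lv lv'].
- move=> w; split=> [[[g h] lw]|[u [v [_ _ ->]]]]; last first.
    by exists (word_eval u, word_eval v); exact: repP.
  have [u lu] := repX g; have [v lv] := repY h.
  exists u, v; split; [by exists g | by exists h |].
  (* The values of [u] and [v] are only conjugate to [g] and [h], so the representatives are
     compared through their common class. *)
  have eq_class : conj_class (word_eval u, word_eval v) = conj_class (g, h).
    by apply: conj_class_eq; apply/conj_class_pair; split; [case: lu | case: lv].
  have := repP (word_eval u, word_eval v); rewrite eq_class => lrep.
  exact: (shortlex_least_uniq tXY lw lrep).
Qed.

Theorem proposition2p1 (G H : groupType) (X : {fset G}) (Y : {fset H})
    (hXinv : inverse_closed X) (hXgen : generates X)
    (hYinv : inverse_closed Y) (hYgen : generates Y) :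
  (forall lt : rel (prod_gens X Y),
      strict_total_order lt ->
      (forall (x : X) (y : Y), lt (prod_gens_inl Y x) (prod_gens_inr X y)) ->
      regular (sph_conj_language
                 (fun x x' : X => lt (prod_gens_inl Y x) (prod_gens_inl Y x'))) ->
      regular (sph_conj_language
                 (fun y y' : Y => lt (prod_gens_inr X y) (prod_gens_inr X y'))) ->
      regular (sph_conj_language lt))
  /\
  (forall (ltX : rel X) (ltY : rel Y) (ltXY : rel (prod_gens X Y)),
      strict_total_order ltX -> strict_total_order ltY ->
      strict_total_order ltXY ->
      rational_series (sph_conj_growth_series ltX) ->
      rational_series (sph_conj_growth_series ltY) ->
      rational_series (sph_conj_growth_series ltXY)).
Proof.
split=> [lt lt_total lt_inl_inr regX regY|ltX ltY ltXY tX tY tXY ratX ratY].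
  rewrite (sph_conj_language_prod lt_total lt_inl_inr hXinv hXgen hYinv hYgen).
  exact: regular_cat (prod_letter_bij lt_total lt_inl_inr) regX regY.
apply: rational_series_mul ratX ratY _.
exact: sph_conj_growth_series_prod.
Qed.
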